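(* Let $m\ge 2$ and $k\ge 1$ be integers. The minimal desingularization of $\mathbb{P}(1,m,mk+1)$ is the complete toric surface whose fan in $\mathbb{Z}^2$ has rays generated by $$\Delta(1)=\left\{\begin{bmatrix}1\\ 0\end{bmatrix},\begin{bmatrix}0\\ 1\end{bmatrix},\begin{bmatrix}-1\\ -k\end{bmatrix},v_0,\ldots,v_m\right\},\qquad v_j=\begin{bmatrix}-j\\ -(jk+1)\end{bmatrix}\ (0\le j\le m).$$
   Context: Let $e_1,e_2$ be the standard basis of $\mathbb{Z}^2$. For relatively prime positive integers $m<n$, $\mathbb{P}(1,m,n)$ is the complete toric surface whose fan in $\mathbb{Z}^2$ has rays generated by $u_1=e_1$, $u_2=e_2$, $u_0=-me_1-ne_2$, the maximal cones being $\sigma_i$ ($i=0,1,2$), where $\sigma_i$ is generated by the two vectors $u_j$ with $j\ne i$. A complete fan in $\mathbb{Z}^2$ is determined by its set $\Delta(1)$ of primitive ray generators: the maximal cones are spanned by pairs of angularly adjacent rays. A two-dimensional cone with primitive generators $v,w$ is non-singular iff $\det|v\; w|=\pm1$. The minimal desingularization of a toric surface is the toric surface given by the coarsest refinement of its fan (fewest rays) all of whose cones are non-singular. *)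

(* Defs.v *)
From HB Require Import structures.
From mathcomp Require Import all_boot all_order all_algebra.
From mathcomp Require Import boolp classical_sets functions cardinality reals.

Set Implicit Arguments.
Unset Strict Implicit.
Unset Printing Implicit Defensive.

Import Order.TTheory GRing.Theory Num.Theory.

Local Open Scope classical_set_scope.
Local Open Scope ring_scope.

(* The lattice is 'cV[int]_2, sitting inside the real plane 'cV[R]_2.
   A toric surface is represented by its fan, a set of cones in 'cV[R]_2. *)

Definition vec2 (a b : int) : 'cV[int]_2 :=
  \col_i (if i == 0 then a else b).

Definition det2 (v w : 'cV[int]_2) : int := \det (row_mx v w : 'M[int]_2).

Definition primitive (v : 'cV[int]_2) : Prop := coprimez (v 0 0) (v 1 0).

Section Fans.
Variable R : realType.

Definition realvec (v : 'cV[int]_2) : 'cV[R]_2 := map_mx intr v.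

Definition cone (s : seq 'cV[int]_2) : set 'cV[R]_2 :=
  [set x | exists2 c : 'I_(size s) -> R, (forall i, 0 <= c i) &
           x = \sum_(i < size s) c i *: realvec s`_i].

Definition rational_polyhedral (C : set 'cV[R]_2) : Prop :=
  exists s, C = cone s.

Definition strongly_convex (C : set 'cV[R]_2) : Prop :=
  C `&` [set x | C (- x)] = [set 0].

Definition pairing (u : 'rV[R]_2) (x : 'cV[R]_2) : R := (u *m x) 0 0.

(* The choice u = 0 makes C a face of itself. *)
Definition is_face (F C : set 'cV[R]_2) : Prop :=
  exists2 u : 'rV[R]_2, (forall x, C x -> 0 <= pairing u x) &
    F = C `&` [set x | pairing u x = 0].

Definition is_fan (S : set (set 'cV[R]_2)) : Prop :=
  [/\ finite_set S,
      forall C, S C -> rational_polyhedral C /\ strongly_convex C,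
      forall C F, S C -> is_face F C -> S F
    & forall C C', S C -> S C' ->
        is_face (C `&` C') C /\ is_face (C `&` C') C'].

Definition support (S : set (set 'cV[R]_2)) : set 'cV[R]_2 :=
  \bigcup_(C in S) C.

Definition complete_fan (S : set (set 'cV[R]_2)) : Prop :=
  is_fan S /\ support S = setT.

Definition ray_gens (S : set (set 'cV[R]_2)) : set 'cV[int]_2 :=
  [set v | primitive v /\ S (cone [:: v])].

(* Only the two-dimensional cones impose a condition: the zero cone and the
   rays are always non-singular. *)
Definition nonsingular (S : set (set 'cV[R]_2)) : Prop :=
  forall v w, primitive v -> primitive w -> det2 v w != 0 ->
    S (cone [:: v; w]) -> `|det2 v w| = 1.

Definition refines (S' S : set (set 'cV[R]_2)) : Prop :=
  support S' = support S /\
  forall C', S' C' -> exists2 C, S C & C' `<=` C.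

Definition nonsingular_refinement (S S' : set (set 'cV[R]_2)) : Prop :=
  [/\ is_fan S', refines S' S & nonsingular S'].

(* S' is the coarsest non-singular refinement of S: every non-singular
   refinement of S refines S' and has at least as many rays. *)
Definition minimal_desingularization (S S' : set (set 'cV[R]_2)) : Prop :=
  nonsingular_refinement S S' /\
  forall S'', nonsingular_refinement S S'' ->
    refines S'' S' /\ (ray_gens S' #<= ray_gens S'')%card.

(* w is the next ray after v counterclockwise, at an angle less than pi. *)
Definition adjacent (D : set 'cV[int]_2) (v w : 'cV[int]_2) : Prop :=
  [/\ D v, D w, 0 < det2 v w &
      forall u, D u -> cone [:: v; w] (realvec u) -> u = v \/ u = w].

Definition fan_of_rays (D : set 'cV[int]_2) : set (set 'cV[R]_2) :=
  [set F | exists v w, adjacent D v w /\ is_face F (cone [:: v; w])].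

Definition wp_ray (m n : nat) (i : 'I_3) : 'cV[int]_2 :=
  nth 0 [:: vec2 (- m%:Z) (- n%:Z); vec2 1 0; vec2 0 1] i.

Definition wp_cone (m n : nat) (i : 'I_3) : set 'cV[R]_2 :=
  cone [seq wp_ray m n j | j <- enum 'I_3 & j != i].

(* The fan of the weighted projective plane P(1,m,n). *)
Definition wp_fan (m n : nat) : set (set 'cV[R]_2) :=
  [set F | exists i : 'I_3, is_face F (wp_cone m n i)].

End Fans.

Arguments fan_of_rays R D : clear implicits.
Arguments wp_fan R m n : clear implicits.

Definition Delta1 (m k : nat) : set 'cV[int]_2 :=
  [set vec2 1 0; vec2 0 1; vec2 (- 1) (- k%:Z)] `|`
  [set vec2 (- j%:Z) (- (j * k + 1)%N%:Z) | j in [set j : nat | (j <= m)%N]].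

(* Main.v *)
(** The generators of Delta(1), in counterclockwise order
      e_1, e_2, (-1,-k), v_m, v_(m-1), ..., v_0, e_1,
    have consecutive determinants 1, and the consecutive sectors cover the
    plane; hence they are exactly the adjacent pairs and span a complete
    non-singular fan.  For minimality, each generator r of Delta(1) lying in a
    cone s_i of P(1,m,mk+1) has height 1 for some integral linear form that is
    at least 1 on the generators of s_i, hence at least 1 on every non-zero
    lattice point of s_i.  So r is not a sum of two such points, and it can
    lie in a unimodular cone contained in s_i only as one of its two
    generators: every ray of Delta(1) is a ray of any non-singular refinement,
    and no cone of the refinement crosses such a ray. *)

Require Import Defs.
From mathcomp Require Import all_boot all_order all_algebra.
From mathcomp Require Import boolp classical_sets functions cardinality reals.
From mathcomp Require Import ring lra zify.

Set Implicit Arguments.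
Unset Strict Implicit.
Unset Printing Implicit Defensive.

Import Order.TTheory GRing.Theory Num.Theory.

(** * Rational cones in the plane *)

Section Geometry.
Local Open Scope classical_set_scope.
Local Open Scope ring_scope.

Lemma det2E (v w : 'cV[int]_2) : det2 v w = v 0 0 * w 1 0 - v 1 0 * w 0 0.
Proof.
have row_mx0 i : row_mx v w i 0 = v i 0.
  by rewrite (_ : 0 = lshift 1 (0 : 'I_1)) ?row_mxEl //; exact: val_inj.
have row_mx1 i : row_mx v w i 1 = w i 0.
  by rewrite (_ : 1 = rshift 1 (0 : 'I_1)) ?row_mxEr //; exact: val_inj.
have l0 (i : 'I_1) : lift (0 : 'I_2) i = 1 by rewrite ord1; exact: val_inj.
have l1 (i : 'I_1) : lift (1 : 'I_2) i = 0 by rewrite ord1; exact: val_inj.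
rewrite /det2; move: (row_mx v w) row_mx0 row_mx1 => M M0 M1.
rewrite (expand_det_row M 0) !big_ord_recl big_ord0 /cofactor !det_mx11 !mxE.
rewrite !l0 l1 !M0 !M1 /= expr0 expr1 mul1r mulN1r addr0 mulrN.
by rewrite [X in _ - X]mulrC.
Qed.

Lemma vec2_0 a b : vec2 a b 0 0 = a. Proof. by rewrite mxE. Qed.
Lemma vec2_1 a b : vec2 a b 1 0 = b. Proof. by rewrite mxE. Qed.

Lemma colvec2P (T : Type) (x y : 'cV[T]_2) :
  x 0 0 = y 0 0 -> x 1 0 = y 1 0 -> x = y.
Proof.
move=> h0 h1; apply/colP => -[[|[|//]] i2]; [move: h0|move: h1].
all: by congr (_ = _); congr (fun_of_matrix _ _ _); apply: val_inj.
Qed.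

Variable R : realType.
Implicit Types (x y z : 'cV[R]_2) (u v w : 'cV[int]_2) (C F : set 'cV[R]_2).

(** The oriented area of [x] and [y]: its sign tells on which side of [x] the vector [y] lies, so
    that angular order around the origin becomes a system of sign conditions. *)
Definition rdet x y : R := x 0 0 * y 1 0 - x 1 0 * y 0 0.

Lemma realvecE v i j : realvec R v i j = (v i j)%:~R.
Proof. by rewrite mxE. Qed.

Lemma rdet_realvec v w : rdet (realvec R v) (realvec R w) = (det2 v w)%:~R.
Proof. by rewrite /rdet !realvecE det2E intrB !intrM. Qed.

Lemma rdetC x y : rdet x y = - rdet y x.
Proof. rewrite /rdet; ring. Qed.

Lemma rdetDr x y z : rdet x (y + z) = rdet x y + rdet x z.
Proof. by rewrite /rdet !mxE; ring. Qed.
Lemma rdetDl x y z : rdet (y + z) x = rdet y x + rdet z x.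
Proof. by rewrite /rdet !mxE; ring. Qed.
Lemma rdetZr x y (a : R) : rdet x (a *: y) = a * rdet x y.
Proof. by rewrite /rdet !mxE; ring. Qed.
Lemma rdetZl x y (a : R) : rdet (a *: x) y = a * rdet x y.
Proof. by rewrite /rdet !mxE; ring. Qed.
Lemma rdetNr x y : rdet x (- y) = - rdet x y.
Proof. by rewrite /rdet !mxE; ring. Qed.
Lemma rdetNl x y : rdet (- x) y = - rdet x y.
Proof. by rewrite /rdet !mxE; ring. Qed.
Lemma rdetxx x : rdet x x = 0.
Proof. by rewrite /rdet; ring. Qed.

(** The Plücker relation between four plane vectors. The variant that follows is the same identity
    with [y] moved to the other side of each determinant, which spares sign changes when the roles
    of clockwise and counterclockwise are exchanged. *)
Lemma rdet_plucker x y z t :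
  rdet y x * rdet z t = rdet x t * rdet y z + rdet z x * rdet y t.
Proof. by rewrite /rdet; ring. Qed.

Lemma rdet_pluckerl x y z t :
  rdet x y * rdet z t = rdet x t * rdet z y + rdet z x * rdet t y.
Proof. by rewrite /rdet; ring. Qed.

Lemma rdet_cramer x y z :
  rdet y z *: x = rdet x z *: y + rdet y x *: z.
Proof. by apply: colvec2P; rewrite !mxE /rdet; ring. Qed.

(** * Cones described by their generators *)

Lemma cone_nil x : cone [::] x <-> x = 0.
Proof.
split=> [[c _ ->]|->]; first by rewrite big_ord0.
by exists (fun=> 0) => [[]//|]; rewrite big_ord0.
Qed.

Lemma cone_cons v s x :
  cone (v :: s) x <->
  exists2 a : R, 0 <= a & exists2 y, cone s y & x = a *: realvec R v + y.
Proof.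
split=> [[c c0 ->]|[a a0 [y [c c0 ->] ->]]].
  exists (c ord0) => //; rewrite big_ord_recl; eexists; last reflexivity.
  by exists (fun i => c (lift ord0 i)).
exists (fun i : 'I_(size s).+1 => if unlift ord0 i is Some j then c j else a).
  by move=> i; case: unliftP.
rewrite /= big_ord_recl unlift_none; congr (_ + _); apply: eq_bigr => i _.
by rewrite liftK.
Qed.

Lemma cone1 v x :
  cone [:: v] x <-> exists2 a : R, 0 <= a & x = a *: realvec R v.
Proof.
rewrite cone_cons; split=> -[a a0].
  by case=> y /cone_nil -> ->; rewrite addr0; exists a.
by move=> ->; exists a => //; exists 0; [exact/cone_nil|rewrite addr0].
Qed.

Lemma cone2 v w x : cone [:: v; w] x <->
  exists a b : R, [/\ 0 <= a, 0 <= b & x = a *: realvec R v + b *: realvec R w].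
Proof.
rewrite cone_cons; split=> [[a a0 [y /cone1[b b0 ->] ->]]|[a [b [a0 b0 ->]]]].
  by exists a, b.
by exists a => //; eexists; last reflexivity; apply/cone1; exists b.
Qed.

Lemma cone2_sym v w : cone [:: v; w] = cone [:: w; v] :> set 'cV[R]_2.
Proof.
by apply/seteqP; split=> x /cone2[a [b [a0 b0 ->]]]; apply/cone2; exists b, a;
  rewrite addrC.
Qed.

(** Cramer's rule: the coefficients of [x] on [v] and [w] are these two determinants divided by the
    positive [det2 v w]. *)
Lemma cone2P v w x : 0 < det2 v w ->
  cone [:: v; w] x <->
  (0 <= rdet (realvec R v) x) /\ (0 <= rdet x (realvec R w)).
Proof.
rewrite -(ltr0z R) -rdet_realvec => d0;
  split=> [/cone2[a [b [a0 b0 ->]]]|[h1 h2]].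
  rewrite rdetDr rdetDl !rdetZr !rdetZl !rdetxx !mulr0 addr0 add0r.
  by rewrite !mulr_ge0 // ltW.
apply/cone2; exists (rdet x (realvec R w) / rdet (realvec R v) (realvec R w)),
  (rdet (realvec R v) x / rdet (realvec R v) (realvec R w)).
split; [by rewrite divr_ge0 // ltW..|].
apply: (scalerI (lt0r_neq0 d0)); rewrite rdet_cramer scalerDr !scalerA.
by congr (_ *: _ + _ *: _); field; rewrite lt0r_neq0.
Qed.

Lemma cone_gen v s : v \in s -> cone s (realvec R v).
Proof.
elim: s => // a s IH; rewrite inE => /orP[/eqP <-|/IH h]; apply/cone_cons.
  exists 1 => //; exists 0; last by rewrite scale1r addr0.
  by exists (fun=> 0) => //; rewrite big1 // => i; rewrite scale0r.
by exists 0 => //; eexists; [exact: h|rewrite scale0r add0r].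
Qed.

Lemma cone0 s : cone s (0 : 'cV[R]_2).
Proof. by exists (fun=> 0) => //; rewrite big1 // => i; rewrite scale0r. Qed.

Lemma coneD s x y : cone s x -> cone s y -> cone s (x + y).
Proof.
move=> [c c0 ->] [d d0 ->]; exists (fun i => c i + d i) => [i|];
  first by rewrite addr_ge0.
by rewrite -big_split; apply: eq_bigr => i _; rewrite scalerDl.
Qed.

Lemma coneZ s (a : R) x : 0 <= a -> cone s x -> cone s (a *: x).
Proof.
move=> a0 [c c0 ->]; exists (fun i => a * c i) => [i|];
  first by rewrite mulr_ge0.
by rewrite scaler_sumr; apply: eq_bigr => i _; rewrite scalerA.
Qed.

Lemma cone_sub s s' : (forall v, v \in s -> cone s' (realvec R v)) ->
  cone s `<=` (cone s' : set 'cV[R]_2).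
Proof.
elim: s => [|v s IH] h x; first by move=> /cone_nil ->; exact: cone0.
move=> /cone_cons[a a0 [y /IH hy ->]].
apply: coneD; last by apply: hy => u us; apply: h; rewrite inE us orbT.
by apply: coneZ => //; apply: h; rewrite inE eqxx.
Qed.

(** * Primitive lattice vectors *)

Lemma primitive_neq0 v : primitive v -> v <> 0.
Proof. by move=> + E; rewrite E /primitive !mxE. Qed.

Lemma realvec0 v : realvec R v = 0 -> v = 0.
Proof.
move=> /colP h; apply/colP => i; move: (h i); rewrite !mxE => /eqP.
by rewrite intr_eq0 => /eqP.
Qed.

(** The Bezout relation of [w] exhibits [v] as an integer multiple [t] of [w]; the Bezout relation
    of [v] then makes [t] a unit of the integers, hence 1 or -1. *)
Lemma primitive_det0 v w : primitive v -> primitive w -> det2 v w = 0 ->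
  v = w \/ v = - w.
Proof.
move=> pv pw; rewrite det2E => /eqP; rewrite subr_eq0 => /eqP d.
have /coprimezP [[p q] /= hv] := pv.
have /coprimezP [[r s] /= hw] := pw.
have v0 : v 0 0 = (r * v 0 0 + s * v 1 0) * w 0 0.
  transitivity ((r * w 0 0 + s * w 1 0) * v 0 0); first by rewrite hw mul1r.
  transitivity (r * v 0 0 * w 0 0 + s * (v 0 0 * w 1 0)); first by ring.
  by rewrite d; ring.
have v1 : v 1 0 = (r * v 0 0 + s * v 1 0) * w 1 0.
  transitivity ((r * w 0 0 + s * w 1 0) * v 1 0); first by rewrite hw mul1r.
  transitivity (r * (v 1 0 * w 0 0) + s * v 1 0 * w 1 0); first by ring.
  by rewrite -d; ring.
move: (r * v 0 0 + s * v 1 0) v0 v1 => t v0 v1.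
have ut : (p * w 0 0 + q * w 1 0) * t = 1.
  by rewrite -[RHS]hv [in RHS]v0 [in RHS]v1; ring.
have : (t == 1) || (t == -1).
  have : t \is a GRing.unit.
    by apply/unitrPr; exists (p * w 0 0 + q * w 1 0); rewrite mulrC.
  by rewrite unfold_in.
case/orP => /eqP et; rewrite et in v0 v1; [left|right].
  by apply: colvec2P; rewrite ?v0 ?v1 mul1r.
by apply: colvec2P; rewrite mxE ?v0 ?v1 mulN1r.
Qed.

Lemma realvecN v : realvec R (- v) = - realvec R v.
Proof. by apply/matrixP => i j; rewrite !mxE intrN. Qed.

(** Proportionality leaves only [v = w] or [v = - w], and the second would give [(1 + a) w = 0] with
    [1 + a > 0]. Thus a ray has a single primitive generator. *)
Lemma primitive_colinear v w (a : R) : 0 <= a -> primitive v -> primitive w ->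
  realvec R v = a *: realvec R w -> v = w.
Proof.
move=> a0 pv pw E.
have d : det2 v w = 0.
  by apply/eqP; rewrite -(intr_eq0 R) -rdet_realvec E rdetZl rdetxx mulr0.
have [//|e2] := primitive_det0 pv pw d.
have := primitive_neq0 pw; move: E; rewrite e2 realvecN.
move=> /eqP; rewrite -subr_eq0 -opprD oppr_eq0 -{1}[realvec R w]scale1r
  -scalerDl scaler_eq0.
by case/orP => [|/eqP /realvec0 //]; rewrite paddr_eq0 ?ler01 ?oner_eq0.
Qed.

Lemma primitive_exists v : v != 0 ->
  exists2 w, primitive w &
  exists2 a : R, 0 < a & realvec R v = a *: realvec R w.
Proof.
move=> v0; set g := gcdz (v 0 0) (v 1 0).
have g0 : 0 < g.
  rewrite lt_neqAle eq_sym gcdz_eq0 [0 <= g]isT andbT;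
    apply: contraNN v0 => /andP[/eqP h0 /eqP h1].
  by apply/eqP/colvec2P; rewrite ?mxE ?h0 ?h1.
have h0 : v 0 0 = divz (v 0 0) g * g by rewrite divzK // dvdz_gcdl.
have h1 : v 1 0 = divz (v 1 0) g * g by rewrite divzK // dvdz_gcdr.
exists (vec2 (divz (v 0 0) g) (divz (v 1 0) g)).
  have [p [q hpq]] := Bezoutz (v 0 0) (v 1 0).
  rewrite /primitive vec2_0 vec2_1; apply/coprimezP; exists (p, q) => /=.
  apply: (mulIf (lt0r_neq0 g0)).
  by rewrite mul1r -[RHS]hpq mulrDl -!mulrA -h0 -h1.
exists (g%:~R); first by rewrite ltr0z.
by apply: colvec2P; rewrite !mxE -intrM /= mulrC -?h0 -?h1.
Qed.

End Geometry.

(** * Faces and strong convexity *)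

Section Faces.
Local Open Scope classical_set_scope.
Local Open Scope ring_scope.
Variable R : realType.
Implicit Types (x y z : 'cV[R]_2) (u v w : 'cV[int]_2) (C F : set 'cV[R]_2).

Lemma pairingD (u : 'rV[R]_2) x y :
  pairing u (x + y) = pairing u x + pairing u y.
Proof. by rewrite /pairing mulmxDr mxE. Qed.

Lemma pairingZ (u : 'rV[R]_2) a x : pairing u (a *: x) = a * pairing u x.
Proof. by rewrite /pairing -scalemxAr mxE. Qed.

Lemma pairingE (a b : R) x :
  pairing (\row_j (if j == 0 then a else b)) x = a * x 0 0 + b * x 1 0.
Proof.
rewrite /pairing !mxE !big_ord_recl big_ord0 !mxE addr0 /=.
by rewrite (_ : lift ord0 ord0 = 1) //; apply: val_inj.
Qed.

(** Supporting forms are supplied as determinants against a fixed vector [y], so that the face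
    conditions follow from bilinearity of [rdet]. *)
Lemma is_face_rdetl F C y : (forall x, C x -> 0 <= rdet y x) ->
  F = C `&` [set x | rdet y x = 0] -> is_face F C.
Proof.
move=> h E; pose u : 'rV[R]_2 := \row_j (if j == 0 then - y 1 0 else y 0 0).
have e x : pairing u x = rdet y x by rewrite pairingE /rdet; ring.
exists u => [x Cx|]; first by rewrite e; exact: h.
by rewrite E; apply/seteqP; split=> x [/= Cx]; rewrite e.
Qed.

Lemma is_face_refl C : is_face C C.
Proof.
have e x : pairing 0 x = 0 by rewrite /pairing mul0mx mxE.
exists 0 => [x _|]; first by rewrite e.
by apply/seteqP; split=> x; [|case]; rewrite //= e.
Qed.

Lemma is_face_zero s F C : C = cone s -> is_face F C -> F 0.
Proof.
move=> -> [u _ ->]; split; first exact: cone0.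
by rewrite /= /pairing mulmx0 mxE.
Qed.

(** A form that is non-negative on all generators kills a non-negative combination only if it kills
    every generator occurring with a non-zero coefficient. So a face is spanned by the generators on
    which the form vanishes. *)
Lemma is_face_cone F s : is_face F (cone s) ->
  exists p : pred 'cV[int]_2, F = cone (filter p s).
Proof.
case=> u upos ->; exists (fun v => pairing u (realvec R v) == 0).
elim: s upos => [|v s IH] upos /=.
  apply/seteqP; split=> x; first by case.
  by move=> /cone_nil ->; split; [exact: cone0|rewrite /= /pairing mulmx0 mxE].
have vpos : 0 <= pairing u (realvec R v).
  by apply: upos; apply: cone_gen; rewrite inE eqxx.
have spos x : cone s x -> 0 <= pairing u x.
  move=> sx; apply: upos; apply/cone_cons; exists 0 => //; exists x => //.
  by rewrite scale0r add0r.
have {}IH := IH spos.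
apply/seteqP; split=> x.
  case=> /cone_cons[a a0 [y sy ->]] /=.
  rewrite pairingD pairingZ => /eqP;
    rewrite paddr_eq0 ?mulr_ge0 ?(spos _ sy) // => /andP[].
  rewrite mulf_eq0 => h /eqP y0.
  have {}sy : cone [seq v <- s | pairing u (realvec R v) == 0] y by rewrite -IH.
  case: (pairing u (realvec R v) =P 0) h => [pv0 _|pv0].
    by apply/cone_cons; exists a => //; exists y.
  by rewrite orbF => /eqP ->; rewrite scale0r add0r.
case: (pairing u (realvec R v) =P 0) => pv0; last first.
  rewrite -IH => -[sx x0]; split=> //.
  apply/cone_cons; exists 0 => //; exists x => //.
  by rewrite scale0r add0r.
move=> /cone_cons[a a0 [y]]; rewrite -IH => -[sy y0 ->]; split.
  by apply/cone_cons; exists a => //; exists y.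
by rewrite /= pairingD pairingZ pv0 y0 mulr0 addr0.
Qed.

Lemma is_face_cone0 F : is_face F (cone [::]) -> F = cone [::].
Proof. by case/is_face_cone. Qed.

Lemma is_face_cone1 v F : is_face F (cone [:: v]) ->
  F = cone [:: v] \/ F = cone [::].
Proof. by case/is_face_cone => p -> /=; case: (p v); [left|right]. Qed.

Lemma is_face_cone2 v w F : is_face F (cone [:: v; w]) ->
  [\/ F = cone [:: v; w], F = cone [:: v], F = cone [:: w] | F = cone [::]].
Proof.
by case/is_face_cone => p -> /=; case: (p v); case: (p w);
  [constructor 1|constructor 2|constructor 3|constructor 4].
Qed.

Lemma face_nil_cone1 v : v <> 0 ->
  is_face (cone [::] : set 'cV[R]_2) (cone [:: v]).
Proof.
move=> v0; have n0 : 0 < (v 0 0)%:~R ^+ 2 + (v 1 0)%:~R ^+ 2 :> R.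
  rewrite lt_neqAle addr_ge0 ?sqr_ge0 // andbT eq_sym paddr_eq0 ?sqr_ge0 //
    !sqrf_eq0 !intr_eq0.
  by apply/negP => /andP[/eqP h0 /eqP h1]; apply: v0; apply: colvec2P;
    rewrite ?h0 ?h1 mxE.
(* [y] is [v] turned by a quarter clockwise, which makes [rdet y] the inner product with [v]. *)
pose y : 'cV[R]_2 := \col_i (if i == 0 then (v 1 0)%:~R else - (v 0 0)%:~R).
have e (a : R) : rdet y (a *: realvec R v)
   = a * ((v 0 0)%:~R ^+ 2 + (v 1 0)%:~R ^+ 2).
  by rewrite /rdet !mxE /=; ring.
apply: (@is_face_rdetl _ _ y) => [x /cone1[a a0 ->]|];
  first by rewrite e mulr_ge0 // ltW.
apply/seteqP; split=> x.
  by move=> /cone_nil ->; split; [exact: cone0|rewrite /= /rdet !mxE; ring].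
move=> [/cone1 [a a0 ->]] /=; rewrite e => /eqP;
  rewrite mulf_eq0 (gt_eqF n0) orbF => /eqP ->.
by rewrite scale0r; exact: cone0.
Qed.

(** * Faces of a two-dimensional cone *)

Section Cone2.
Variables v w : 'cV[int]_2.
Hypothesis d0 : 0 < det2 v w.

Let r0 : 0 < rdet (realvec R v) (realvec R w).
Proof. by rewrite rdet_realvec ltr0z. Qed.

Lemma face_cone1_l : is_face (cone [:: v] : set 'cV[R]_2) (cone [:: v; w]).
Proof.
have e (a b : R) : rdet (realvec R v) (a *: realvec R v + b *: realvec R w) =
  b * rdet (realvec R v) (realvec R w).
  by rewrite rdetDr !rdetZr rdetxx mulr0 add0r.
apply: (@is_face_rdetl _ _ (realvec R v)) => [x /cone2 [a [b [a0 b0 ->]]]|].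
  by rewrite e mulr_ge0 // ltW.
apply/seteqP; split=> x.
  move=> /cone1[a a0 ->]; split; last by rewrite /= rdetZr rdetxx mulr0.
  by apply/cone2; exists a, 0; rewrite scale0r addr0.
case=> /cone2 [a [b [a0 b0 ->]]] /=; rewrite e => /eqP;
  rewrite mulf_eq0 (gt_eqF r0) orbF => /eqP ->.
by apply/cone1; exists a => //; rewrite scale0r addr0.
Qed.

Lemma face_cone1_r : is_face (cone [:: w] : set 'cV[R]_2) (cone [:: v; w]).
Proof.
have e (a b : R) : rdet (- realvec R w) (a *: realvec R v + b *: realvec R w) =
  a * rdet (realvec R v) (realvec R w).
  by rewrite rdetNl -rdetC rdetDl !rdetZl rdetxx mulr0 addr0.
apply: (@is_face_rdetl _ _ (- realvec R w)) => [x /cone2 [a [b [a0 b0 ->]]]|].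
  by rewrite e mulr_ge0 // ltW.
apply/seteqP; split=> x.
  move=> /cone1[a a0 ->]; split;
    last by rewrite /= rdetNl rdetZr rdetxx mulr0 oppr0.
  by apply/cone2; exists 0, a; rewrite scale0r add0r.
case=> /cone2 [a [b [a0 b0 ->]]] /=; rewrite e => /eqP;
  rewrite mulf_eq0 (gt_eqF r0) orbF => /eqP ->.
by apply/cone1; exists b => //; rewrite scale0r add0r.
Qed.

Lemma face_nil_cone2 : is_face (cone [::] : set 'cV[R]_2) (cone [:: v; w]).
Proof.
(* The form [rdet (v - w)] takes the same positive value on [v] and on [w], so on the cone it
   vanishes only at the origin. *)
have e (a b : R) :
  rdet (realvec R v - realvec R w) (a *: realvec R v + b *: realvec R w) =
  (a + b) * rdet (realvec R v) (realvec R w).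
  rewrite rdetDl !rdetNl !rdetDr !rdetZr !rdetxx.
  by rewrite [rdet (realvec R w) _]rdetC; ring.
apply: (@is_face_rdetl _ _ (realvec R v - realvec R w)) =>
  [x /cone2 [a [b [a0 b0 ->]]]|].
  by rewrite e mulr_ge0 //; [exact: addr_ge0|exact: ltW].
apply/seteqP; split=> x.
  by move=> /cone_nil ->; split; [exact: cone0|rewrite /= /rdet !mxE; ring].
case=> /cone2 [a [b [a0 b0 ->]]] /=; rewrite e => /eqP;
  rewrite mulf_eq0 (gt_eqF r0) orbF paddr_eq0 // => /andP[/eqP -> /eqP ->].
by apply/cone_nil; rewrite !scale0r addr0.
Qed.

Lemma strongly_convex_cone2 : strongly_convex (cone [:: v; w] : set 'cV[R]_2).
Proof.
apply/seteqP; split=> x; last first.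
  by move=> ->; split=> /=; rewrite ?oppr0; exact: cone0.
case=> /(cone2P _ d0) [h1 h2] /= /(cone2P _ d0);
  rewrite rdetNr rdetNl !oppr_ge0 => -[h3 h4] /=.
apply: (scalerI (lt0r_neq0 r0)); rewrite rdet_cramer scaler0.
have -> : rdet x (realvec R w) = 0 by apply/eqP; rewrite eq_le h2 h4.
have -> : rdet (realvec R v) x = 0 by apply/eqP; rewrite eq_le h1 h3.
by rewrite !scale0r addr0.
Qed.

End Cone2.

Lemma strongly_convex_sub C F : F 0 -> F `<=` C -> strongly_convex C ->
  strongly_convex F.
Proof.
move=> F0 FC sC; apply/seteqP; split=> x.
  by case=> /FC Cx /FC Cnx; rewrite -sC.
by move=> ->; split; rewrite //= oppr0.
Qed.

Lemma strongly_convexN C x : strongly_convex C -> C x -> C (- x) -> x = 0.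
Proof. by move=> sC Cx Cnx; have : [set 0] x by rewrite -sC. Qed.

Lemma cone_cons_pos v w s (a : R) : 0 < a -> realvec R v = a *: realvec R w ->
  cone (v :: s) = cone (w :: s) :> set 'cV[R]_2.
Proof.
move=> a0 E; apply/seteqP; split=> x /cone_cons [b b0 [y sy ->]];
  apply/cone_cons.
  exists (b * a); first by rewrite mulr_ge0 // ltW.
  by exists y => //; rewrite E scalerA.
exists (b / a); first by rewrite divr_ge0 // ltW.
by exists y => //; rewrite E scalerA divfK ?lt0r_neq0.
Qed.

Lemma cone_set_eq s s' : (forall v, v \in s -> cone s' (realvec R v)) ->
  (forall v, v \in s' -> cone s (realvec R v)) ->
  cone s = (cone s' : set 'cV[R]_2).
Proof. by move=> h h'; apply/seteqP; split; exact: cone_sub. Qed.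

(** Induction on the list of generators: the position of the new one relative to the cone already
    described decides which generators remain extremal. Strong convexity excludes the configurations
    that would produce a line or a half-plane. *)
Lemma strongly_convex_cone s : strongly_convex (cone s : set 'cV[R]_2) ->
  [\/ cone s = (cone [::] : set 'cV[R]_2),
      exists2 v, primitive v & cone s = (cone [:: v] : set 'cV[R]_2)
    | exists v w, [/\ primitive v, primitive w, 0 < det2 v w &
        cone s = (cone [:: v; w] : set 'cV[R]_2)]].
Proof.
elim: s => [|a s IH] sC; first by constructor 1.
have sub : cone s `<=` (cone (a :: s) : set 'cV[R]_2).
  by apply: cone_sub => v vs; apply: cone_gen; rewrite inE vs orbT.
have {}IH := IH (strongly_convex_sub (@cone0 _ _) sub sC).
have ca : cone (a :: s) (realvec R a) by apply: cone_gen; rewrite inE eqxx.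
have cE s' : cone s = cone s' :> set 'cV[R]_2 ->
  cone (a :: s) = cone (a :: s') :> set 'cV[R]_2.
  by move=> E; apply/seteqP; split=> x /cone_cons H; apply/cone_cons;
    [rewrite -E|rewrite E].
have cS s' : cone s = cone s' :> set 'cV[R]_2 -> cone s' (realvec R a) ->
  cone (a :: s) = cone s' :> set 'cV[R]_2.
  move=> E h; rewrite (cE s') //; apply: cone_set_eq => v; last first.
    by move=> vs; apply: cone_gen; rewrite inE vs orbT.
  by rewrite inE => /orP [/eqP ->//|]; exact: cone_gen.
have [a0|/eqP/(primitive_exists R) [a' pa' [t t0 ta]]] := pselect (a = 0).
  have E : cone (a :: s) = cone s :> set 'cV[R]_2.
    apply: cS => //; rewrite a0 (_ : realvec R 0 = 0); first exact: cone0.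
    by apply/matrixP=> i j; rewrite !mxE.
  by rewrite E.
have ca' : cone (a :: s) (realvec R a').
  rewrite (_ : realvec R a' = t^-1 *: realvec R a);
    last by rewrite ta scalerA mulVf ?scale1r ?lt0r_neq0.
  by apply: coneZ ca; rewrite invr_ge0 ltW.
have cP s' : cone s = cone s' :> set 'cV[R]_2 ->
  cone (a :: s) = cone (a' :: s') :> set 'cV[R]_2.
  by move=> E; rewrite (cE _ E); apply: cone_cons_pos ta.
have na' : cone (a :: s) (- realvec R a') -> False.
  by move=> h; apply: (primitive_neq0 pa'); apply: (@realvec0 R);
    apply: strongly_convexN ca' h.
case: IH => [E|[v pv E]|[v [w [pv pw d0 E]]]].
- by constructor 2; exists a' => //; rewrite (cP _ E).
- have [d|d|d] := ltgtP (det2 v a') 0.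
  + constructor 3; exists a', v; split=> //; last by rewrite (cP _ E).
    by move: d; rewrite !det2E; lia.
  + by constructor 3; exists v, a'; split=> //; rewrite (cP _ E) cone2_sym.
  constructor 2; exists v => //; rewrite (cP _ E).
  have [->|av] := primitive_det0 pv pa' d.
    by apply: cone_set_eq => u; rewrite !inE ?orbb => /eqP->; apply: cone_gen;
      rewrite !inE eqxx.
  case: na'; rewrite -realvecN -av; apply: sub; rewrite E.
  by apply: cone_gen; rewrite inE.
have Ea := cP _ E.
(* With both signs reversed, [- a'] would lie in the cone of [v] and [w]. Three positions remain:
   [a'] inside this cone, beyond [w] (replacing [w]), or before [v] (replacing [v]). *)
have hN : det2 v a' <= 0 -> det2 a' w <= 0 -> False.
  move=> h1 h2; apply: na'; rewrite -realvecN; apply: sub; rewrite E;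
    apply/(cone2P _ d0).
  by rewrite !realvecN rdetNr rdetNl !rdet_realvec !oppr_ge0 !lerz0.
have [h1|h1] := leP 0 (det2 v a').
  have [h2|h2] := leP 0 (det2 a' w).
    constructor 3; exists v, w; split=> //; rewrite Ea.
    apply: cone_set_eq => u; rewrite !inE; [case/or3P|case/orP] => /eqP ->.
    all: try by apply: cone_gen; rewrite !inE eqxx ?orbT.
    by apply/(cone2P _ d0); rewrite !rdet_realvec !ler0z.
  have h1' : 0 < det2 v a'.
    rewrite lt_neqAle h1 eq_sym andbT; apply/negP => /eqP h.
    by apply: hN; rewrite ?h // ltW.
  constructor 3; exists v, a'; split=> //; rewrite Ea.
  apply: cone_set_eq => u; rewrite !inE; [case/or3P|case/orP] => /eqP ->.
  all: try by apply: cone_gen; rewrite !inE eqxx ?orbT.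
  apply/(cone2P _ h1'); rewrite !rdet_realvec !ler0z ltW //; split=> //.
  by move: h2; rewrite !det2E; lia.
have h2 : 0 < det2 a' w.
  by rewrite ltNge; apply/negP => h; apply: hN => //; exact: ltW.
constructor 3; exists a', w; split=> //; rewrite Ea.
apply: cone_set_eq => u; rewrite !inE; [case/or3P|case/orP] => /eqP ->.
all: try by apply: cone_gen; rewrite !inE eqxx ?orbT.
apply/(cone2P _ h2); rewrite !rdet_realvec !ler0z (ltW d0); split=> //.
by move: h1; rewrite !det2E; lia.
Qed.

End Faces.

(** * The fan of a set of rays *)

Section FanOfRays.
Local Open Scope classical_set_scope.
Local Open Scope ring_scope.
Variable R : realType.
Implicit Types (x y z : 'cV[R]_2) (u v w : 'cV[int]_2) (C F : set 'cV[R]_2).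

Lemma cone1_inter v s : cone [:: v] `&` cone s = (cone [:: v] : set 'cV[R]_2) \/
  cone [:: v] `&` cone s = (cone [::] : set 'cV[R]_2).
Proof.
have [sv|sv] := pselect (cone s (realvec R v)).
  left; apply/seteqP; split=> x; first by case.
  by move=> vx; split=> //; move: vx => /cone1 [a a0 ->]; exact: coneZ.
right; apply/seteqP; split=> x; last first.
  by move=> /cone_nil ->; split; exact: cone0.
case=> /cone1[a a0 ->] sa; apply/cone_nil.
have [->|an0] := eqVneq a 0; first by rewrite scale0r.
case: sv; rewrite (_ : realvec R v = a^-1 *: (a *: realvec R v)).
  by apply: coneZ => //; rewrite invr_ge0.
by rewrite scalerA mulVf // scale1r.
Qed.

(* By the Pluecker relations, r strictly between v and x would lie inside the
   cone of v and w; hence v is not before r, and symmetrically w not after s. *)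
Lemma overlap_sub v w r s x : 0 < det2 v w -> 0 < det2 r s ->
  (cone [:: v; w] (realvec R r) -> r = v \/ r = w) ->
  (cone [:: v; w] (realvec R s) -> s = v \/ s = w) ->
  0 < rdet (realvec R v) x -> 0 < rdet x (realvec R w) ->
  cone [:: r; s] x -> cone [:: v; w] `<=` (cone [:: r; s] : set 'cV[R]_2).
Proof.
move=> d d' Hr Hs h1 h2 /(cone2P x d') [h3 h4].
have rd : 0 < rdet (realvec R v) (realvec R w) by rewrite rdet_realvec ltr0z.
have rd' : 0 < rdet (realvec R r) (realvec R s) by rewrite rdet_realvec ltr0z.
have rv : 0 <= rdet (realvec R r) (realvec R v).
  rewrite leNgt; apply/negP => h; case: Hr => [|E|E].
  - apply/(cone2P _ d); rewrite [in X in X /\ _]rdetC oppr_ge0 ltW //;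
      split=> //.
    rewrite -(pmulr_rge0 _ h1).
    have := rdet_plucker x (realvec R r) (realvec R v) (realvec R w).
    have := mulr_ge0 h3 (ltW rd); have := mulr_ge0_le0 (ltW h2) (ltW h); lra.
  - by move: h; rewrite E rdetxx ltxx.
  - by move: h2 h3; rewrite {}E rdetC; lra.
have ws : 0 <= rdet (realvec R w) (realvec R s).
  rewrite leNgt; apply/negP => h; case: Hs => [|E|E].
  - apply/(cone2P _ d); rewrite [in X in _ /\ X]rdetC oppr_ge0 (ltW h);
      split=> //.
    rewrite -(pmulr_rge0 _ h2).
    have := rdet_pluckerl x (realvec R s) (realvec R v) (realvec R w).
    have := mulr_ge0 h4 (ltW rd); have := mulr_ge0_le0 (ltW h1) (ltW h); lra.
  - by move: h1 h4; rewrite {}E rdetC; lra.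
  - by move: h; rewrite E rdetxx ltxx.
(* What remains is that [v] is not past [s] and [w] is not before [r]. Since [x] lies in both cones,
   a failure would equate a positive product with a non-positive sum in the Plücker relation. *)
apply: cone_sub => u; rewrite !inE => /orP[] /eqP ->; apply/(cone2P _ d');
  split=> //.
  rewrite leNgt; apply/negP => h.
  have := rdet_plucker x (realvec R v) (realvec R r) (realvec R s).
  have := mulr_gt0 h1 rd'; have := mulr_ge0_le0 h3 (ltW h).
  have := mulr_ge0 h4 rv.
  rewrite [rdet (realvec R v) (realvec R r)]rdetC; lra.
rewrite leNgt; apply/negP => h.
have := rdet_pluckerl x (realvec R w) (realvec R r) (realvec R s).
have := mulr_gt0 h2 rd'; have := mulr_ge0_le0 h4 (ltW h).
have := mulr_ge0 h3 ws.
rewrite [rdet (realvec R s) (realvec R w)]rdetC; lra.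
Qed.

Variable D : set 'cV[int]_2.
Hypothesis Dfin : finite_set D.
Hypothesis Dprim : forall v, D v -> primitive v.

Lemma adjacent_det v w : adjacent R D v w ->
  0 < rdet (realvec R v) (realvec R w).
Proof. by case=> _ _ d _; rewrite rdet_realvec ltr0z. Qed.

Lemma adjacent_in v w u : adjacent R D v w -> D u ->
  0 <= rdet (realvec R v) (realvec R u) ->
  0 <= rdet (realvec R u) (realvec R w) -> u = v \/ u = w.
Proof. by case=> _ _ d h Du h1 h2; apply: h => //; apply/cone2P. Qed.

(** The first sector is contained in the second, so adjacency of [r] and [s] makes each of [v], [w]
    one of them; the position of [x] excludes the swapped assignment. *)
Lemma adjacent_overlap v w r s x : adjacent R D v w -> adjacent R D r s ->
  0 < rdet (realvec R v) x -> 0 < rdet x (realvec R w) ->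
  cone [:: r; s] x -> v = r /\ w = s.
Proof.
move=> [Dv Dw d A] [Dr Ds d' A'] h1 h2 crs.
have sub := overlap_sub d d' (A _ Dr) (A _ Ds) h1 h2 crs.
have [h3 h4] := (cone2P x d').1 crs.
have cv : cone [:: r; s] (realvec R v).
  by apply: sub; apply: cone_gen; rewrite inE eqxx.
have cw : cone [:: r; s] (realvec R w).
  by apply: sub; apply: cone_gen; rewrite !inE eqxx orbT.
split.
  by case: (A' _ Dv cv) => // E; exfalso; move: h1 h4; rewrite {}E rdetC; lra.
by case: (A' _ Dw cw) => // E; exfalso; move: h2 h3; rewrite {}E rdetC; lra.
Qed.

Local Notation fan := (fan_of_rays R D).

Lemma fan_of_raysP F : fan F <-> exists v w, adjacent R D v w /\
  [\/ F = cone [:: v; w], F = cone [:: v], F = cone [:: w] | F = cone [::]].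
Proof.
split=> -[v [w [A H]]]; exists v, w; split=> //; first exact: is_face_cone2.
have [_ _ d _] := A.
case: H => ->; [exact: is_face_refl|exact: face_cone1_l|
  exact: face_cone1_r|exact: face_nil_cone2].
Qed.

Lemma fan_cases F : fan F ->
  [\/ F = cone [::], exists2 v, D v & F = cone [:: v] |
  exists v w, adjacent R D v w /\ F = cone [:: v; w]].
Proof.
case/fan_of_raysP => v [w [A]]; have [Dv Dw _ _] := A; case=> ->.
- by constructor 3; exists v, w.
- by constructor 2; exists v.
- by constructor 2; exists w.
- by constructor 1.
Qed.

Lemma fan_interior v w F x : adjacent R D v w -> fan F -> F x ->
  0 < rdet (realvec R v) x -> 0 < rdet x (realvec R w) -> F = cone [:: v; w].
Proof.
move=> A /fan_cases [->|[u Du ->]|[v' [w' [A' ->]]]].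
- by move=> /cone_nil -> ; rewrite /rdet !mxE !mulr0 subrr ltxx.
- move=> /cone1[a a0 ->]; rewrite rdetZr rdetZl => h1 h2.
  have ap : 0 < a.
    rewrite lt_neqAle a0 andbT; apply/eqP => a0'.
    by rewrite -a0' mul0r ltxx in h1.
  move: h1 h2; rewrite !pmulr_rgt0 // => h1 h2.
  by case: (adjacent_in A Du (ltW h1) (ltW h2)) => E; move: h1 h2;
    rewrite E rdetxx ltxx.
- move=> c h1 h2.
  by have [-> ->] := adjacent_overlap A A' h1 h2 c.
Qed.

(** For a sector [F] different from [F'], only boundary points of [F] can be common. The
    intersection is then decided by which of the two boundary rays lie in [F']; if both did, [F']
    would contain the interior point [v + w] and equal [F]. *)
Lemma fan_inter F F' : fan F -> fan F' -> is_face (F `&` F') F.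
Proof.
move=> fF fF'.
have [s' Es'] : exists s', F' = cone s'.
  by case: (fan_cases fF') => [->|[v _ ->]|[v [w [_ ->]]]]; eexists.
case: (fan_cases fF) => [->|[v Dv ->]|[v [w [A EF]]]].
- rewrite (_ : _ `&` _ = cone [::]); first exact: is_face_refl.
  rewrite Es'; apply/seteqP; split=> x; first by case.
  by move=> h; split=> //; move: h => /cone_nil ->; exact: cone0.
- rewrite Es'; case: (cone1_inter v s') => ->; first exact: is_face_refl.
  by apply: face_nil_cone1; exact: primitive_neq0 (Dprim Dv).
have [E|nE] := pselect (F' = F); first by rewrite E setIid; exact: is_face_refl.
have [_ _ d _] := A; have rd := adjacent_det A.
have bd x : F x -> F' x -> cone [:: v] x \/ cone [:: w] x.
  rewrite {1}EF => Fx F'x; have [h1 h2] := (cone2P x d).1 Fx.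
  move: (Fx) => /cone2 [a [b [a0 b0 E]]].
  have [b0'|bn0] := eqVneq b 0.
    by left; apply/cone1; exists a => //; rewrite E b0' scale0r addr0.
  have [a0'|an0] := eqVneq a 0.
    by right; apply/cone1; exists b => //; rewrite E a0' scale0r add0r.
  have {}bp : 0 < b by rewrite lt_neqAle eq_sym bn0.
  have {}ap : 0 < a by rewrite lt_neqAle eq_sym an0.
  case: nE; rewrite EF; apply: (fan_interior A fF' F'x).
    by rewrite E rdetDr !rdetZr rdetxx mulr0 add0r mulr_gt0.
  by rewrite E rdetDl !rdetZl rdetxx mulr0 addr0 mulr_gt0.
have cvw x : cone [:: v] x \/ cone [:: w] x -> F x.
  rewrite EF; case; apply: cone_sub => u; rewrite inE => /eqP ->;
    apply: cone_gen; rewrite !inE eqxx ?orbT //.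
have gs u : cone [:: u] `<=` F' \/ cone [:: u] `&` F' = cone [::].
  rewrite Es'; case: (cone1_inter u s') => E; [left=> x|by right].
  by rewrite -E; case.
have z : F 0 /\ F' 0 by rewrite EF Es'; split; exact: cone0.
have [hv|hv] := gs v; have [hw|hw] := gs w.
- have Fv : F' (realvec R v + realvec R w).
    by rewrite Es'; apply: coneD; rewrite -Es'; [apply: hv|apply: hw];
      apply: cone_gen; rewrite inE.
  case: nE; rewrite EF; apply: (fan_interior A fF' Fv).
    by rewrite rdetDr rdetxx add0r.
  by rewrite rdetDl rdetxx addr0.
- rewrite (_ : F `&` F' = cone [:: v]); last first.
    apply/seteqP; split=> x; last first.
      by move=> h; split; [apply: cvw; left|exact: hv].
    case=> Fx F'x; case: (bd _ Fx F'x) => // h.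
    by have /cone_nil -> : cone [::] x by [rewrite -hw]; exact: cone0.
  by rewrite EF; exact: face_cone1_l.
- rewrite (_ : F `&` F' = cone [:: w]); last first.
    apply/seteqP; split=> x; last first.
      by move=> h; split; [apply: cvw; right|exact: hw].
    case=> Fx F'x; case: (bd _ Fx F'x) => // h.
    by have /cone_nil -> : cone [::] x by [rewrite -hv]; exact: cone0.
  by rewrite EF; exact: face_cone1_r.
- rewrite (_ : F `&` F' = cone [::]); first by rewrite EF;
    exact: face_nil_cone2.
  apply/seteqP; split=> x; last by move=> /cone_nil ->.
  by case=> Fx F'x; case: (bd _ Fx F'x) => ?; [rewrite -hv|rewrite -hw].
Qed.

Lemma fan_of_rays_is_fan : is_fan fan.
Proof.
split.
- pose G (s : seq 'cV[int]_2) : set 'cV[R]_2 := cone s.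
  pose G2 := [set G [:: v; w] | v in D & w in D].
  pose G1 := [set G [:: v] | v in D].
  apply: (@sub_finite_set _ _ (G2 `|` (G1 `|` [set G [::]]))).
    move=> F /fan_cases [->|[v Dv ->]|[v [w [[Dv Dw _ _] ->]]]].
    + by right; right.
    + by right; left; exists v.
    + by left; exists v => //; exists w.
  rewrite !finite_setU; split; first exact: finite_image2.
  by split; [exact: finite_image|exact: finite_set1].
- move=> F [v [w [A fF]]]; have [_ _ d _] := A; split.
    by case: (is_face_cone fF) => p ->; eexists.
  apply: (strongly_convex_sub _ _ (@strongly_convex_cone2 R v w d)).
    exact: (is_face_zero erefl fF).
  by case: fF => u _ -> x [].
- move=> C F /fan_of_raysP [v [w [A H]]] fF; apply/fan_of_raysP; exists v, w;
    split=> //.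
  case: H fF => -> => [/is_face_cone2 //|/is_face_cone1[] ->|
    /is_face_cone1[] ->|/is_face_cone0 ->];
    by [constructor 2|constructor 3|constructor 4].
- move=> C C' fC fC'; split; first exact: fan_inter.
  by rewrite setIC; exact: fan_inter.
Qed.

Lemma ray_gens_fan v : ray_gens fan v -> D v.
Proof.
case=> pv /fan_cases [E|[u Du E]|[u [w [A E]]]].
- have : cone [::] (realvec R v) by rewrite -E; apply: cone_gen; rewrite inE.
  by move=> /cone_nil /realvec0 /(primitive_neq0 pv).
- have : cone [:: u] (realvec R v) by rewrite -E; apply: cone_gen; rewrite inE.
  by move=> /cone1 [a a0 /(primitive_colinear a0 pv (Dprim Du)) ->].
- have := adjacent_det A.
  have : cone [:: v] (realvec R u).
    by rewrite E; apply: cone_gen; rewrite !inE eqxx.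
  have : cone [:: v] (realvec R w).
    by rewrite E; apply: cone_gen; rewrite !inE eqxx orbT.
  move=> /cone1 [a a0 ->] /cone1 [b b0 ->].
  by rewrite rdetZl rdetZr rdetxx !mulr0 ltxx.
Qed.

End FanOfRays.

(** * The rays Delta(1) *)

Section Delta.
Local Open Scope classical_set_scope.
Local Open Scope ring_scope.

Variables (R : realType) (m k : nat).
Hypotheses (hm : (2 <= m)%N) (hk : (1 <= k)%N).
Implicit Types (x y z : 'cV[R]_2) (u v w : 'cV[int]_2) (C F : set 'cV[R]_2).

Lemma det2_vec2 a b c d : det2 (vec2 a b) (vec2 c d) = a * d - b * c.
Proof. by rewrite det2E !vec2_0 !vec2_1. Qed.

Local Notation e1 := (vec2 1 0).
Local Notation e2 := (vec2 0 1).
Local Notation wk := (vec2 (- 1) (- k%:Z)).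
Local Notation vj j := (vec2 (- j%:Z) (- (j * k + 1)%N%:Z)).

Lemma Delta1P u : Delta1 m k u <->
  [\/ u = e1, u = e2, u = wk | exists2 j, (j <= m)%N & u = vj j].
Proof.
split=> [[[[->|->]|->]|[j jm <-]]|[->|->|->|[j jm ->]]].
- by constructor 1.
- by constructor 2.
- by constructor 3.
- by constructor 4; exists j.
- by left; left; left.
- by left; left; right.
- by left; right.
- by right; exists j.
Qed.

Lemma Delta1_finite : finite_set (Delta1 m k).
Proof.
rewrite /Delta1 !finite_setU; split; first by split; [split|];
  exact: finite_set1.
apply: finite_image; rewrite (_ : [set j | _] = `I_m.+1) //; exact: finite_II.
Qed.

Lemma Delta1_primitive v : Delta1 m k v -> primitive v.
Proof.
rewrite /primitive; case/Delta1P => [->|->|->|[j jm ->]];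
  rewrite !vec2_0 !vec2_1; apply/coprimezP.
- by exists (1, 0).
- by exists (0, 1).
- by exists (-1, 0); rewrite mul0r addr0 mulrNN.
- exists (k%:Z, -1) => /=; rewrite PoszD PoszM; ring.
Qed.

(** The neighbours in counterclockwise order, listed explicitly; the index of the [vj] decreases
    along the turn. This makes finite case analysis possible, and it is shown below to agree with
    [adjacent]. *)
Inductive consecutive : 'cV[int]_2 -> 'cV[int]_2 -> Prop :=
| Consec_e1 : consecutive e1 e2
| Consec_e2 : consecutive e2 wk
| Consec_w : consecutive wk (vj m)
| Consec_v i of (i < m)%N : consecutive (vj i.+1) (vj i)
| Consec_v0 : consecutive (vj 0%N) e1.

Lemma consecutive_det v w : consecutive v w -> det2 v w = 1.
Proof. by case=> [|||i im|]; rewrite det2_vec2; nia. Qed.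

Lemma consecutive_in v w : consecutive v w -> Delta1 m k v /\ Delta1 m k w.
Proof.
by case=> [|||i im|]; split; apply/Delta1P;
  do ?[by constructor 1|by constructor 2|by constructor 3|constructor 4;
    eexists; last reflexivity]; lia.
Qed.

Lemma consecutive_adjacent v w : consecutive v w -> adjacent R (Delta1 m k) v w.
Proof.
move=> c; have [Dv Dw] := consecutive_in c; have d := consecutive_det c.
have d0 : 0 < det2 v w by rewrite d.
split=> // u Du /(cone2P _ d0); rewrite !rdet_realvec !ler0z.
case: c {Dv Dw d d0} => [|||i im|]; case/Delta1P: Du => [->|->|->|[j jm ->]];
  rewrite !det2_vec2 => -[h1 h2];
  do ?[by left|by right]; try by (exfalso; nia).
(* Only generators [vj j] are left: [j = m] in the sector after [wk], [j] equal to [i.+1] or [i] in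
   a middle sector, and [j = 0] in the sector before [e1]. *)
- right; congr vec2; nia.
- have /orP[/eqP->|/eqP->] : (j == i.+1) || (j == i) by nia.
    by left.
  by right.
- left; congr vec2; nia.
Qed.

(** * Completeness of the fan and its rays *)

Lemma consecutive_cover x : exists v w, consecutive v w /\ cone [:: v; w] x.
Proof.
have cP v w : consecutive v w -> cone [:: v; w] x <->
  (0 <= rdet (realvec R v) x) /\ (0 <= rdet x (realvec R w)).
  by move=> c; apply: cone2P; rewrite (consecutive_det c).
have E a b : realvec R (vec2 a b) 0 0 = a%:~R /\
  realvec R (vec2 a b) 1 0 = b%:~R.
  by rewrite !realvecE vec2_0 vec2_1.
suff : exists v w, consecutive v w /\ (0 <= rdet (realvec R v) x) /\
  (0 <= rdet x (realvec R w)).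
  by case=> v [w [c h]]; exists v, w; split=> //; apply/cP.
pose a := x 0 0; pose b := x 1 0.
(* The determinant of [x] and [vj j]. It is affine in [j] with slope [rdet x wk], because [vj j]
   equals [vj 0] plus [j] times [wk]. *)
pose f (j : nat) : R := - a + j%:R * (b - k%:R * a).
have fE j : rdet x (realvec R (vj j)) = f j.
  rewrite /rdet !(E _ _).1 !(E _ _).2 /f -/a -/b !intrN -!pmulrn natrD natrM;
    ring.
have [a0|a0] := leP 0 a.
  have [b0|b0] := leP 0 b.
    exists e1, e2; split; first by constructor.
    by rewrite /rdet !(E _ _).1 !(E _ _).2 -/a -/b; split; nra.
  exists (vj 0), e1; split; first by constructor.
  rewrite rdetC fE /f /rdet !(E _ _).1 !(E _ _).2 -/a -/b; split; nra.
have [h|h] := leP 0 (b - k%:R * a).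
  exists e2, wk; split; first by constructor.
  rewrite /rdet !(E _ _).1 !(E _ _).2 -/a -/b !intrN -!pmulrn; split; nra.
have [h'|h'] := leP 0 (f m).
  exists wk, (vj m); split; first by constructor.
  rewrite fE /rdet !(E _ _).1 !(E _ _).2 -/a -/b !intrN -!pmulrn; split; nra.
(* Discrete intermediate value: [f] is positive at 0 and negative at [m], and a change of sign
   between [i] and [i.+1] places [x] between [vj i.+1] and [vj i]. *)
have [i im [fi fi1]] : exists2 i, (i < m)%N & 0 <= f i /\ f i.+1 < 0.
  have f0 : 0 <= f 0%N by rewrite /f; lra.
  clear -f0 h'; elim: m h' => [|n IH] fn; first by lra.
  have [fn'|fn'] := leP 0 (f n); first by exists n.
  by have [i i_n H] := IH fn'; exists i => //; exact: ltnW.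
exists (vj i.+1), (vj i); split; first by constructor.
by rewrite rdetC !fE; split=> //; lra.
Qed.

(** The interior point [v + w] lies in some consecutive sector, and two adjacent sectors that
    overlap in an interior point coincide. *)
Lemma adjacent_consecutive v w : adjacent R (Delta1 m k) v w -> consecutive v w.
Proof.
move=> A; have [v' [w' [c cx]]] := 
  consecutive_cover (realvec R v + realvec R w).
have d := adjacent_det A.
have [|| -> ->] := adjacent_overlap A (consecutive_adjacent c) _ _ cx => //.
  by rewrite rdetDr rdetxx add0r.
by rewrite rdetDl rdetxx addr0.
Qed.

Local Notation fan := (fan_of_rays R (Delta1 m k)).

Lemma consecutive_fan v w : consecutive v w -> fan (cone [:: v; w]).
Proof.
move=> c; exists v, w.
by split; [exact: consecutive_adjacent|exact: is_face_refl].
Qed.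

Lemma Delta1_complete : complete_fan fan.
Proof.
split; first exact: (fan_of_rays_is_fan R Delta1_finite Delta1_primitive).
apply/seteqP; split=> // x _; have [v [w [c cx]]] := consecutive_cover x.
by exists (cone [:: v; w]) => //; exact: consecutive_fan.
Qed.

Lemma Delta1_ray_gens : ray_gens fan = Delta1 m k.
Proof.
apply/seteqP; split=> v; first exact: (ray_gens_fan Delta1_primitive).
move=> Dv; split; first exact: Delta1_primitive.
apply/fan_of_raysP.
have [w [c|c]] : exists w, consecutive v w \/ consecutive w v.
  case/Delta1P: Dv => [->|->|->|[j jm ->]].
  - by exists e2; left; constructor.
  - by exists wk; left; constructor.
  - by exists (vj m); left; constructor.
  - case: j jm => [|j] jm; first by exists e1; left; constructor.
    by exists (vj j); left; constructor.
- by exists v, w; split; [exact: consecutive_adjacent|constructor 2].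
- by exists w, v; split; [exact: consecutive_adjacent|constructor 3].
Qed.

(** * The cones of P(1,m,mk+1) and heights on them *)

Local Notation n := (m * k + 1)%N.
Local Notation wp i := (wp_cone m n i : set 'cV[R]_2).

(** For this [n] the ray generator u_0 is [vj m]. Generators are put in counterclockwise order, so
    that [cone2P] applies. *)
Lemma wp_coneE :
  [/\ wp 0 = cone [:: e1; e2], wp 1 = cone [:: e2; vj m] &
      wp 2 = cone [:: vj m; e1]].
Proof.
by split; rewrite /wp_cone !enum_ordSl (_ : enum 'I_0 = [::]) ?enum_ord0 //=
  1?cone2_sym.
Qed.

Lemma ord3P (i : 'I_3) : [\/ i = 0, i = 1 | i = 2].
Proof.
by case: i => -[|[|[|//]]] h; [constructor 1|constructor 2|constructor 3];
  exact: val_inj.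
Qed.

Lemma consecutive_sub_wp v w :
  consecutive v w -> exists i, cone [:: v; w] `<=` wp i.
Proof.
have [w0 w1 w2] := wp_coneE.
have d1 : 0 < det2 e2 (vj m) by rewrite det2_vec2; nia.
have d2 : 0 < det2 (vj m) e1 by rewrite det2_vec2; nia.
have S g h : 0 < det2 g h ->
  0 <= det2 g v -> 0 <= det2 v h -> 0 <= det2 g w -> 0 <= det2 w h ->
  cone [:: v; w] `<=` (cone [:: g; h] : set 'cV[R]_2).
  move=> d *; apply: cone_sub => u.
  by rewrite !inE => /orP[]/eqP ->; apply/(cone2P _ d);
    rewrite !rdet_realvec !ler0z.
move=> c; case: c S => [|||i im|] S.
- by exists 0; rewrite w0.
- by exists 1; rewrite w1; apply: S => //; rewrite det2_vec2; nia.
- by exists 1; rewrite w1; apply: S => //; rewrite det2_vec2; nia.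
- by exists 2; rewrite w2; apply: S => //; rewrite det2_vec2; nia.
- by exists 2; rewrite w2; apply: S => //; rewrite det2_vec2; nia.
Qed.

Definition height (a b : int) v : int := a * v 0 0 + b * v 1 0.

(* The linear form is the one equal to 1 on both generators of a sector of
   Delta(1) that contains u and lies in the i-th cone. *)
Lemma Delta1_height i u : Delta1 m k u -> wp i (realvec R u) ->
  exists g h a b, [/\ wp i = cone [:: g; h], height a b u = 1,
                      1 <= height a b g & 1 <= height a b h].
Proof.
have [w0 w1 w2] := wp_coneE.
have d1 : 0 < det2 e2 (vj m) by rewrite det2_vec2; nia.
have d2 : 0 < det2 (vj m) e1 by rewrite det2_vec2; nia.
have d0 : 0 < det2 e1 e2 by rewrite det2_vec2.
have H (a b c d : int) : height a b (vec2 c d) = a * c + b * d.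
  by rewrite /height vec2_0 vec2_1.
move=> Du; case: (ord3P i) => ->; rewrite ?w0 ?w1 ?w2 => /cone2P;
  rewrite !rdet_realvec !ler0z.
- move=> /(_ d0) h; exists e1, e2, 1, 1; rewrite !H; split=> //.
  by move: h; case/Delta1P: Du => [->|->|->|[j jm ->]];
    rewrite !H !det2_vec2 => -[h1 h2]; nia.
- move=> /(_ d1) h; exists e2, (vj m).
  case/Delta1P: Du h => [->|->|->|[j jm ->]]; rewrite !det2_vec2 => -[h1 h2].
  + exfalso; nia.
  (* The form of the sector of [e2] and [wk]. Its value on [vj m] is [m - 1], which is where
     [m >= 2] enters. *)
  + by exists (- (k.+1)%:Z), 1; rewrite !H; split=> //; nia.
  + by exists (- (k.+1)%:Z), 1; rewrite !H; split=> //; nia.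
  + have -> : j = m by nia.
    (* The form of the sector of [wk] and [vj m], with value [m - 1] on [e2]. *)
    exists (- 1 - k%:Z * (m%:Z - 1)), (m%:Z - 1).
    by rewrite !H; split=> //; nia.
- move=> /(_ d2) h; exists (vj m), e1.
  case/Delta1P: Du h => [->|->|->|[j jm ->]]; rewrite !det2_vec2 => -[h1 h2].
  + by exists 1, (-1); rewrite !H; split=> //; nia.
  + exfalso; nia.
  + exfalso; nia.
  (* This form is 1 on every [vj j]: these points lie on one line. Its value on [e1] is [k], at
     least 1. *)
  + by exists k%:Z, (-1); rewrite !H; split=> //; nia.
Qed.

(** The height is a non-negative real combination, not all coefficients zero, of positive values,
    hence positive; being an integer, it is at least 1. *)
Lemma height_ge1 g h a b v : 1 <= height a b g -> 1 <= height a b h -> v <> 0 ->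
  cone [:: g; h] (realvec R v) -> 1 <= height a b v.
Proof.
move=> hg hh v0 /cone2 [c [d [c0 d0 E]]].
rewrite -gtz0_ge1 -(ltr0z R).
have Hr u : (height a b u)%:~R =
  a%:~R * realvec R u 0 0 + b%:~R * realvec R u 1 0.
  by rewrite /height !realvecE intrD !intrM.
have -> : (height a b v)%:~R = c * (height a b g)%:~R + d * (height a b h)%:~R.
  by rewrite !Hr E !mxE; ring.
have hg' : 0 < (height a b g)%:~R :> R by rewrite ltr0z; lia.
have hh' : 0 < (height a b h)%:~R :> R by rewrite ltr0z; lia.
rewrite lt_neqAle addr_ge0 ?mulr_ge0 ?(ltW hg') ?(ltW hh') // andbT eq_sym.
rewrite paddr_eq0 ?mulr_ge0 ?(ltW hg') ?(ltW hh') // !mulf_eq0 (gt_eqF hg')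
  (gt_eqF hh') !orbF.
apply/negP => /andP [/eqP c00 /eqP d00]; apply: v0; apply: (@realvec0 R).
by rewrite E c00 d00 !scale0r addr0.
Qed.

(** Unimodularity gives [u] non-negative integer coordinates on [v] and [w]. Heights of [v] and [w]
    are at least 1 and that of [u] is 1, so one coordinate is 1 and the other 0. *)
Lemma Delta1_indecomposable i v w u : primitive v -> primitive w ->
  det2 v w = 1 -> cone [:: v; w] `<=` wp i ->
  Delta1 m k u -> cone [:: v; w] (realvec R u) -> u = v \/ u = w.
Proof.
move=> pv pw d sub Du cu.
have [g [h [a [b [E hu hg hh]]]]] := Delta1_height Du (sub _ cu).
have hv : 1 <= height a b v.
  apply: height_ge1 hg hh (primitive_neq0 pv) _; rewrite -E.
  by apply: sub; apply: cone_gen; rewrite inE eqxx.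
have hw : 1 <= height a b w.
  apply: height_ge1 hg hh (primitive_neq0 pw) _; rewrite -E.
  by apply: sub; apply: cone_gen; rewrite !inE eqxx orbT.
have d0 : 0 < det2 v w by rewrite d.
move: cu => /(cone2P _ d0); rewrite !rdet_realvec !ler0z => -[h1 h2].
have E0 : u 0 0 = det2 u w * v 0 0 + det2 v u * w 0 0.
  by rewrite -[LHS]mul1r -d !det2E; ring.
have E1 : u 1 0 = det2 u w * v 1 0 + det2 v u * w 1 0.
  by rewrite -[LHS]mul1r -d !det2E; ring.
have Eh : det2 u w * height a b v + det2 v u * height a b w = 1.
  by rewrite -hu /height E0 E1; ring.
have : (det2 u w = 1 /\ det2 v u = 0) \/ (det2 u w = 0 /\ det2 v u = 1) by nia.
case=> -[D1 D2]; rewrite D1 D2 !mul1r !mul0r ?addr0 ?add0r in E0 E1;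
  [left|right]; exact: colvec2P.
Qed.

Lemma wp_fan_sub F : wp_fan R m n F -> exists i, F `<=` wp i.
Proof. by case=> i [u _ ->]; exists i => x []. Qed.

(** * Comparison with an arbitrary non-singular refinement *)

Section Minimal.
Variable S : set (set 'cV[R]_2).
Hypothesis HS : nonsingular_refinement (wp_fan R m n) S.

Lemma refinement_cases F : S F ->
  [\/ F = cone [::], exists2 v, primitive v & F = cone [:: v] |
  exists v w, [/\ primitive v, primitive w, det2 v w = 1, F = cone [:: v; w] &
    forall u, Delta1 m k u -> cone [:: v; w] (realvec R u) -> u = v \/ u = w]].
Proof.
move=> SF; have [[_ HSc _ _] [_ ref] ns] := HS.
have [[s Es] sc] := HSc _ SF.
rewrite Es in sc *;
  case: (strongly_convex_cone sc) => [->|[v pv ->]|[v [w [pv pw d E]]]].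
- by constructor 1.
- by constructor 2; exists v.
constructor 3; exists v, w; rewrite Es E in SF.
have d1 : det2 v w = 1.
  by have := ns v w pv pw (lt0r_neq0 d) SF; rewrite gtr0_norm.
have [F' /wp_fan_sub [i F'i] FF'] := ref _ SF.
by split=> // u; apply: Delta1_indecomposable => //;
  exact: subset_trans FF' F'i.
Qed.

(** Choose the sector of Delta(1) containing [v + w]. Its two rays do not enter the interior of the
    cone of [v] and [w], so this cone cannot cross the boundary of the sector. *)
Lemma refinement_refines F : S F -> exists2 C, fan C & F `<=` C.
Proof.
case/refinement_cases => [->|[v pv ->]|[v [w [pv pw d -> H]]]].
- exists (cone [:: e1; e2]); first by apply: consecutive_fan; constructor.
  by move=> x /cone_nil ->; exact: cone0.
- have [r [s [c cv]]] := consecutive_cover (realvec R v).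
  exists (cone [:: r; s]); first exact: consecutive_fan.
  by apply: cone_sub => u; rewrite inE => /eqP ->.
have [r [s [c cv]]] := consecutive_cover (realvec R v + realvec R w).
exists (cone [:: r; s]); first exact: consecutive_fan.
have [Dr Ds] := consecutive_in c.
have d0 : 0 < det2 v w by rewrite d.
have d0' : 0 < det2 r s by rewrite (consecutive_det c).
apply: (overlap_sub d0 d0' (H _ Dr) (H _ Ds) _ _ cv).
  by rewrite rdetDr rdetxx add0r rdet_realvec ltr0z.
by rewrite rdetDl rdetxx addr0 rdet_realvec ltr0z.
Qed.

(** Some cone of [S] contains [u]; indecomposability makes [u] one of its generators, and closure
    under faces then puts the ray of [u] in [S]. *)
Lemma refinement_rays : Defs.support S = setT -> Delta1 m k `<=` ray_gens S.
Proof.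
move=> sS u Du; have pu := Delta1_primitive Du; split=> //.
have [F SF Fu] : Defs.support S (realvec R u) by rewrite sS.
have [[_ _ HSf _] _ _] := HS.
case: (refinement_cases SF) => [E|[v pv E]|[v [w [pv pw d E H]]]];
  rewrite E in SF Fu.
- by have := primitive_neq0 pu; move/cone_nil/realvec0: Fu.
- by move: Fu => /cone1 [a a0 /(primitive_colinear a0 pu pv) ->].
have d0 : 0 < det2 v w by rewrite d.
by case: (H u Du Fu) => ->; apply: HSf SF _;
  [exact: face_cone1_l|exact: face_cone1_r].
Qed.

End Minimal.

Lemma fan_refines_wp F : fan F -> exists2 C, wp_fan R m n C & F `<=` C.
Proof.
case=> v [w [A [u _ ->]]];
  have [i sub] := consecutive_sub_wp (adjacent_consecutive A).
by exists (wp i) => [|x [/sub]//]; exists i; exact: is_face_refl.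
Qed.

Lemma support_wp_fan : Defs.support (wp_fan R m n) = setT.
Proof.
apply/seteqP; split=> // x _; have [_ fS] := Delta1_complete.
have [F /fan_refines_wp [C wC FC] Fx] : Defs.support fan x by rewrite fS.
by exists C => //; exact: FC.
Qed.

(** [nonsingular] quantifies over all primitive generators of a cone, not only adjacent pairs. Here
    [v] and [w] span faces, hence are rays of the fan lying in the sector of [r] and [s], so they
    are [r] and [s] in some order and the determinant is 1 or -1. *)
Lemma fan_nonsingular : nonsingular fan.
Proof.
move=> v w pv pw d0 /fan_cases [E|[u Du E]|[r [s [A E]]]].
- have := primitive_neq0 pv; case; apply: (@realvec0 R); apply/cone_nil;
    rewrite -E.
  by apply: cone_gen; rewrite inE eqxx.
- have h : forall t, t \in [:: v; w] -> primitive t -> t = u.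
    move=> t tin pt.
    have /cone1[a a0] : cone [:: u] (realvec R t).
      by rewrite -E; exact: cone_gen.
    exact: primitive_colinear a0 pt (Delta1_primitive Du).
  have vu : v = u by apply: h => //; rewrite inE eqxx.
  have wu : w = u by apply: h => //; rewrite !inE eqxx orbT.
  by move: d0; rewrite vu wu det2E mulrC subrr eqxx.
have c := adjacent_consecutive A; have d := consecutive_det c.
have fE : fan (cone [:: v; w]) by rewrite E; exact: consecutive_fan.
have face t : t \in [:: v; w] ->
  is_face (cone [:: t] : set 'cV[R]_2) (cone [:: v; w]).
  have [dn|dp|d0'] := ltgtP (det2 v w) 0; last by rewrite d0' eqxx in d0.
    have dp : 0 < det2 w v by move: dn; rewrite !det2E; lia.
    by rewrite cone2_sym !inE => /orP[]/eqP ->;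
      [exact: face_cone1_r|exact: face_cone1_l].
  by rewrite !inE => /orP[]/eqP ->; [exact: face_cone1_l|exact: face_cone1_r].
have [[_ _ fan_face _] _] := Delta1_complete; have [_ _ _ adj] := A.
have rs t : t \in [:: v; w] -> primitive t -> t = r \/ t = s.
  move=> tin pt; apply: adj; last by rewrite -E; exact: cone_gen.
  by rewrite -Delta1_ray_gens; split=> //; apply: fan_face fE _; exact: face.
have det_tt t : det2 t t = 0 by rewrite det2E; ring.
have drs : det2 s r = - 1 by rewrite -d !det2E; ring.
by case: (rs v) (rs w) d0 => [||->|->];
  rewrite ?inE ?eqxx ?orbT // => -[//|//|->|->];
  rewrite ?det_tt ?eqxx ?d ?drs.
Qed.

Lemma Delta1_minimal_desingularization :
  minimal_desingularization (wp_fan R m n) fan.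
Proof.
have [fan_is_fan fS] := Delta1_complete.
split.
  split=> //; last exact: fan_nonsingular.
  by split; [rewrite fS support_wp_fan|exact: fan_refines_wp].
move=> S HS; have [_ [sS _] _] := HS; rewrite support_wp_fan in sS; split.
  by split; [rewrite fS sS|exact: refinement_refines].
by rewrite Delta1_ray_gens; apply: subset_card_le; exact: refinement_rays.
Qed.

End Delta.

Theorem corollary5p8 (R : realType) (m k : nat)
    (hm : (2 <= m)%N) (hk : (1 <= k)%N) :
  [/\ complete_fan (fan_of_rays R (Delta1 m k)),
      ray_gens (fan_of_rays R (Delta1 m k)) = Delta1 m k
    & minimal_desingularization (wp_fan R m (m * k + 1)%N)
        (fan_of_rays R (Delta1 m k))].
Proof.
split.
- exact: Delta1_complete.
- exact: Delta1_ray_gens.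
- exact: Delta1_minimal_desingularization.
Qed.
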